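(* Every rooted graph $(G,i)$ allows the nullity pairs $(0,0)$ and $(1,0)$ with the SNIP.
   Context: All matrices are real. For a simple graph $G$ on $[n]$, $\mathcal{S}(G)$ is the set of real symmetric $n\times n$ matrices whose off-diagonal $(j,k)$ entry is nonzero iff $\{j,k\}\in E(G)$ (diagonal free). $A(i)$ is $A$ with row and column $i$ deleted; a $0\times0$ matrix has nullity $0$. $A$ has the $i$-SNIP if $X=O$ is the only real symmetric $X$ with $A\circ X=O$, $I\circ X=O$ and $(AX)(i,:]=O$ ($AX$ with row $i$ deleted). A rooted graph $(G,i)$ ($i\in V(G)$) allows $(k,\ell)$ with the SNIP if some $A\in\mathcal{S}(G)$ with the $i$-SNIP has $(\operatorname{null}(A),\operatorname{null}(A(i)))=(k,\ell)$. *)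

(* Defs.v *)
From mathcomp Require Import all_boot all_order all_algebra.
From mathcomp Require Import reals.

Set Implicit Arguments.
Unset Strict Implicit.
Unset Printing Implicit Defensive.

Import GRing.Theory.
Local Open Scope ring_scope.

Record sgraph (n : nat) := SGraph {
  adj :> rel 'I_n;
  adj_sym : symmetric adj;
  adj_irr : irreflexive adj
}.

Section Defs.
Variable R : realType.

Definition symmx n (A : 'M[R]_n) : Prop := A^T = A.

Definition hadamard n (A B : 'M[R]_n) : 'M[R]_n := map2_mx *%R A B.

Definition in_SG n (G : sgraph n) (A : 'M[R]_n) : Prop :=
  symmx A /\ forall j k : 'I_n, j != k -> (A j k != 0 <-> G j k).

(* The column space of [cokermx A] is the null space {x | A *m x = 0}. *)
Definition nullity n (A : 'M[R]_n) : nat := \rank (cokermx A).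

Definition delrc n (i : 'I_n) (A : 'M[R]_n) : 'M[R]_n.-1 := row' i (col' i A).

Definition has_SNIP n (i : 'I_n) (A : 'M[R]_n) : Prop :=
  forall X : 'M[R]_n, symmx X ->
    hadamard A X = 0 -> hadamard 1%:M X = 0 -> row' i (A *m X) = 0 -> X = 0.

Definition allows_SNIP n (G : sgraph n) (i : 'I_n) (k l : nat) : Prop :=
  exists A : 'M[R]_n,
    [/\ in_SG G A, has_SNIP i A & (nullity A, nullity (delrc i A)) = (k, l)].

End Defs.

(* Main.v *)
Require Import Defs.
From mathcomp Require Import all_boot all_order all_algebra.
From mathcomp Require Import reals.

(** If the principal submatrix [A(i)] is invertible, then [A] has the [i]-SNIP:
    column [i] of the equation [(AX)(i,:] = O] reads [A(i) x = 0] because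
    [X i i = 0], so column and row [i] of [X] vanish, and what remains is
    [A(i) X(i) = O].  It thus suffices to find [A] in [S(G)] with [A(i)]
    invertible and [det A] prescribed.  Take diagonal entries 1 and
    off-diagonal entries 0 or 2: [det A(i)] is then an odd integer.  The
    remaining entry [A i i] enters [det A] affinely with slope [det A(i)], so
    it can be chosen to make [det A] equal to 0 or 1. *)

Set Implicit Arguments.
Unset Strict Implicit.
Unset Printing Implicit Defensive.

Import GRing.Theory Num.Theory.
Local Open Scope ring_scope.

Section NullityPairs.
Variable R : realType.

Lemma unitmx_delrc_SNIP n (i : 'I_n) (A : 'M[R]_n) :
  delrc i A \in unitmx -> has_SNIP i A.
Proof.
case: n i A => [[]//|n] i A uB X symX _ diagX AX0.
have Xii : X i i = 0.
  by move/matrixP/(_ i i): diagX; rewrite !mxE eqxx mul1r.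
(* The term of index [i] is split off the product. It vanishes in column [i], where [X i i = 0], and
   then everywhere once row [i] of [X] is known to be zero. *)
have entryE j k : (row' i (A *m X)) j k
    = A (lift i j) i * X i k + (delrc i A *m row' i X) j k.
  rewrite !mxE (bigD1_ord i) //=; congr (_ + _).
  by apply: eq_bigr => l _; rewrite !mxE.
have coli0 : col i (row' i X) = 0.
  apply: (can_inj (mulKmx uB)); rewrite mulmx0 colE mulmxA -colE.
  apply/colP => j; move/matrixP/(_ j i): AX0.
  by rewrite entryE Xii mulr0 add0r [RHS]mxE => BX; rewrite mxE BX mxE.
have Xi0 k : X i k = 0.
  case: (unliftP i k) => [k' ->|->] //.
  by rewrite -[X]symX mxE; move/colP/(_ k'): coli0; rewrite !mxE.
have rowi0 : row' i X = 0.
  apply: (can_inj (mulKmx uB)); rewrite mulmx0; apply/matrixP => j k.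
  by move/matrixP/(_ j k): AX0; rewrite entryE Xi0 mulr0 add0r => ->; rewrite !mxE.
apply/matrixP => j k; rewrite mxE; case: (unliftP i j) => [j' ->|->] //.
by move/matrixP/(_ j' k): rowi0; rewrite !mxE.
Qed.

Lemma nullity_unitmx n (A : 'M[R]_n) : A \in unitmx -> nullity A = 0%N.
Proof. by rewrite /nullity mxrank_coker => /mxrank_unit ->; rewrite subnn. Qed.

(** Deleting a row and a column cannot raise the rank, so [A] has rank at least the order of the
    invertible A(i), and singularity excludes full rank. *)
Lemma nullity_det0_delrc n (i : 'I_n) (A : 'M[R]_n) :
  \det A = 0 -> delrc i A \in unitmx -> nullity A = 1%N.
Proof.
case: n i A => [[]//|n] i A detA0 uB; rewrite /nullity mxrank_coker.
have rank_lt : (\rank A < n.+1)%N.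
  rewrite ltn_neqAle rank_leq_row andbT -/(row_free A) row_free_unit unitmxE.
  by rewrite detA0 unitr0.
have rank_ge : (n <= \rank A)%N.
  have rankB : \rank (delrc i A) = n := mxrank_unit uB.
  apply: leq_trans (eq_leq (esym rankB)) _.
  rewrite /delrc row'Esub; apply: leq_trans (mxrankS (rowsub_sub _ _)) _.
  by rewrite -mxrank_tr tr_col' row'Esub -[leqRHS]mxrank_tr mxrankS ?rowsub_sub.
have -> : \rank A = n by apply/eqP; rewrite eqn_leq rank_ge -ltnS rank_lt.
by rewrite subSnn.
Qed.

(** Modulo 2 the matrix is the identity, so its integer determinant cannot be 0, and it stays
    nonzero in [R], of characteristic 0. *)
Lemma unitmx_odd n (N : 'M[int]_n) :
  map_mx intr (1%:M + N *+ 2) \in (unitmx : pred 'M[R]_n).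
Proof.
rewrite unitmxE unitfE det_map_mx intr_eq0; apply/eqP => det0.
have : \det (map_mx intr (1%:M + N *+ 2) : 'M['F_2]_n) = 1.
  rewrite map_mxD map_mx1 raddfMn /=.
  suff -> : map_mx intr N *+ 2 = 0 :> 'M['F_2]_n by rewrite addr0 det1.
  by apply/matrixP => j k; rewrite mulmxnE mxE -mulr_natr pchar_Fp_0 // mulr0 mxE.
by rewrite det_map_mx det0.
Qed.

Definition graph_mx n (G : sgraph n) (i : 'I_n) (a : R) : 'M[R]_n :=
  \matrix_(j, k) if j == k then if j == i then a else 1 else 2 *+ G j k.

Lemma graph_mx_in_SG n (G : sgraph n) i a : in_SG G (graph_mx G i a).
Proof.
split=> [|j k /negPf jk]; last first.
  by rewrite mxE jk; case: (G j k); rewrite ?mulr1n ?mulr0n ?pnatr_eq0 ?eqxx.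
apply/matrixP => j k; rewrite !mxE eq_sym adj_sym.
by case: eqP => // ->.
Qed.

Lemma graph_mx_delrc_unit n (G : sgraph n) i a :
  delrc i (graph_mx G i a) \in unitmx.
Proof.
case: n G i => [? []//|n] G i.
suff -> : delrc i (graph_mx G i a)
    = map_mx intr (1%:M + (\matrix_(j, k) (G (lift i j) (lift i k))%:R) *+ 2).
  exact: unitmx_odd.
apply/matrixP => j k; rewrite !mxE (inj_eq lift_inj).
rewrite [lift i j == i]eq_sym (negPf (neq_lift i j)).
(* On the diagonal, irreflexivity of [G] removes the even part; off it, both sides are 2 or 0. *)
by case: eqP => [->|_]; rewrite ?adj_irr ?addr0 ?add0r //; case: (G _ _).
Qed.

Lemma graph_mx_det n (G : sgraph n) i (d : R) :
  exists a, \det (graph_mx G i a) = d.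
Proof.
case: n G i => [? []//|n] G i.
(* [s] collects the Laplace terms along row [i] other than the diagonal one. Evaluating at 0 loses
   nothing, since the parameter occurs only at position [(i, i)], which no cofactor of row [i]
   sees. *)
pose A := graph_mx G i; pose s := \sum_(j | j != i) A 0 i j * cofactor (A 0) i j.
have cofE a j : cofactor (A a) i j = cofactor (A 0) i j.
  congr (_ * \det _); apply/matrixP => l m.
  by rewrite !mxE [lift i l == i]eq_sym (negPf (neq_lift i l)).
have detE a : \det (A a) = a * \det (delrc i (A 0)) + s.
  rewrite (expand_det_row _ i) (bigD1 i) //= cofE; congr (_ + _).
    by rewrite /cofactor mxE !eqxx addnn -signr_odd odd_double mul1r.
  by apply: eq_bigr => j ji; rewrite cofE !mxE eq_sym (negPf ji).
have := graph_mx_delrc_unit G i 0; rewrite unitmxE unitfE => nz.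
by exists ((d - s) / \det (delrc i (A 0))); rewrite detE divfK ?subrK.
Qed.

End NullityPairs.

Theorem proposition4p1 (R : realType) (n : nat) (G : sgraph n) (i : 'I_n) :
  allows_SNIP R G i 0 0 /\ allows_SNIP R G i 1 0.
Proof.
split.
- have [a deta] := @graph_mx_det R n G i 1; have uB := graph_mx_delrc_unit G i a.
  exists (graph_mx G i a); split; first exact: graph_mx_in_SG.
    exact: unitmx_delrc_SNIP.
  by rewrite !nullity_unitmx // unitmxE deta unitr1.
- have [a deta] := @graph_mx_det R n G i 0; have uB := graph_mx_delrc_unit G i a.
  exists (graph_mx G i a); split; first exact: graph_mx_in_SG.
    exact: unitmx_delrc_SNIP.
  by rewrite (nullity_det0_delrc deta uB) nullity_unitmx.
Qed.
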